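(* There do not exist two disconnected maximal cliques in the derangement graph $X_6$.
   Context: A derangement is a permutation with no fixed points. The derangement graph $X_6$ is the undirected graph with vertex set $S_6$, with an edge between $\sigma$ and $\tau$ if and only if $\sigma\tau^{-1}$ is a derangement. A clique is a set of pairwise adjacent vertices; it is maximal if it is not properly contained in another clique. Two cliques are disconnected if there is no edge between a vertex of one and a vertex of the other. *)

(* Defs.v *)
From mathcomp Require Import all_boot all_fingroup.

Set Implicit Arguments.
Unset Strict Implicit.
Unset Printing Implicit Defensive.

Local Open Scope group_scope.

Definition derangement (T : finType) (s : {perm T}) : bool :=
  [forall x, s x != x].

(* In [perm], [s * t] applies [s] first.  With either composition order
   this relation says that [s x != t x] for all [x]. *)
Definition derangement_graph (n : nat) : rel 'S_n :=
  fun s t => derangement (s * t^-1).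

Definition clique (T : finType) (e : rel T) (C : {set T}) : bool :=
  [forall x in C, forall y in C, (x != y) ==> e x y].

Definition maximal_clique (T : finType) (e : rel T) (C : {set T}) : bool := maxset (clique e) C.

Definition disconnected (T : finType) (e : rel T) (C D : {set T}) : bool :=
  [forall x in C, forall y in D, ~~ e x y].

(* Main.v *)
Require Import Defs.
From mathcomp Require Import all_boot all_fingroup.

(** By Hall's theorem every Latin rectangle extends to a Latin square, so a
    maximal clique of the derangement graph of [S_n] consists of the [n] rows
    of a Latin square.  If two such cliques [C] and [D] are disconnected, every
    row of [C] agrees with every row of [D] somewhere; as the rows of [D] cover
    each cell of a row of [C] exactly once, it agrees with each of them exactly
    once.  (This is a pair of orthogonal Latin squares, so the theorem is
    Tarry's solution of Euler's problem of the 36 officers.)  For [n = 6],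
    multiply both cliques on the right so that the identity lies in [C].  Then
    each row of [D] has exactly one fixed point, and a short exhaustive search
    finds no such squares. *)

Set Implicit Arguments.
Unset Strict Implicit.
Unset Printing Implicit Defensive.

(** * Hall's marriage theorem *)

(* Rado's argument: if [r x] contains [a != b], then one of them can be
   deleted from [r x] without violating Hall's condition; otherwise two
   violating sets [A] and [B] contradict the condition for [x |: A :|: B] and
   [A :&: B] together, by submodularity of [#|\bigcup_(y in A) r y|]. *)
Lemma hall_marriage (T U : finType) (r : T -> {set U}) :
    (forall A : {set T}, #|A| <= #|\bigcup_(x in A) r x|) ->
  exists2 f : T -> U, injective f & forall x, f x \in r x.
Proof.
have [m] := ubnP (\sum_x #|r x|); elim: m r => // m IHm r ltm hallr.
have r_gt0 x : 0 < #|r x| by have := hallr [set x]; rewrite cards1 big_set1.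
(* When all the [r x] are singletons the choice is forced, and the condition for pairs makes it
   injective. *)
have [x r_gt1 | r_le1] := pickP (fun x => 1 < #|r x|); last first.
  have r1 x : exists y, r x == [set y].
    have /cards1P[y ->] : #|r x| == 1 by rewrite eqn_leq r_gt0 leqNgt r_le1.
    by exists y.
  have rE x := eqP (xchooseP (r1 x)).
  exists (fun x => xchoose (r1 x)) => [x y /= fxy|x]; last first.
    by rewrite [in X in _ \in X]rE inE.
  apply/eqP/idPn => neq_xy.
  have := hallr [set x; y].
  rewrite cards2 neq_xy big_setU1 ?inE // big_set1 rE [r y]rE fxy /=.
  by rewrite setUid cards1.
have [a [b [ar br neq_ab]]] := card_gt1P r_gt1.
pose del c y := if y == x then r x :\ c else r y.
have hall_del c : c \in r x ->
    (exists2 f : T -> U, injective f & forall y, f y \in r y) \/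
    exists2 A : {set T}, x \notin A &
      #|(\bigcup_(y in A) r y) :|: (r x :\ c)| <= #|A|.
  move=> cr.
  have [/forallP hallc|] :=
      boolP [forall A : {set T}, #|A| <= #|\bigcup_(y in A) del c y|].
    left; have [|f injf fr] := IHm (del c) _ hallc.
      rewrite -ltnS; apply: leq_trans ltm; rewrite ltnS.
      rewrite (bigD1 x) //= [ltnRHS](bigD1 x) //= /del eqxx.
      rewrite (cardsD1 c (r x)) cr add1n addSn ltnS leq_add2l.
      by apply: leq_sum => y /negbTE->.
    exists f => // y; have := fr y.
    by rewrite /del; case: eqP => [->|//] /setD1P[].
  rewrite negb_forall => /existsP[A]; rewrite -ltnNge => ltA; right.
  have delE (B : {set T}) :
      x \notin B -> \bigcup_(y in B) del c y = \bigcup_(y in B) r y.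
    move=> xB; apply: eq_bigr => y yB; rewrite /del.
    by case: eqP yB xB => // -> ->.
  (* A violating set contains [x], since [del c] alters only [r x]; removing [x] from it turns [<]
     into [<=]. *)
  have [xA|xA] := boolP (x \in A); last first.
    by have := hallr A; rewrite -delE // leqNgt ltA.
  exists (A :\ x); first by rewrite !inE eqxx.
  move: ltA; rewrite (cardsD1 x) xA ltnS; apply: leq_trans.
  by rewrite (big_setD1 x xA) /= delE ?inE ?eqxx // {1}/del eqxx setUC.
have [//|[A xA leA]] := hall_del a ar.
have [//|[B xB leB]] := hall_del b br.
set rA := _ :|: _ in leA; set rB := _ :|: _ in leB.
have xAB : x \notin A :|: B by rewrite inE negb_or xA.
have := leq_add (hallr (x |: (A :|: B))) (hallr (A :&: B)).
rewrite cardsU1 xAB -addnA cardsUI leqNgt ltnS; case/negP.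
apply: leq_trans (leq_add leA leB); rewrite -[leqRHS]cardsUI leq_add //.
  (* As [a != b], every element of [r x] survives in [r x :\ a] or in [r x :\ b]. *)
  apply/subset_leq_card/subsetP=> u /bigcupP[y].
  rewrite !inE => yxAB uy; rewrite -/rA.
  case/or3P: yxAB uy => [/eqP-> ur | yA uy | yB uy].
  - by rewrite ur !andbT; case: (u =P a) => [->|]; rewrite ?neq_ab ?orbT.
  - by apply/orP; left; apply/orP; left; apply/bigcupP; exists y.
  - by apply/orP; right; apply/orP; left; apply/bigcupP; exists y.
apply/subset_leq_card/subsetP=> u /bigcupP[y /setIP[yA yB] uy].
by rewrite !inE; apply/andP; split; apply/orP; left; apply/bigcupP; exists y.
Qed.

(** Hall's condition by double counting: the pairs [(x, u)] with [x] in [A] and [u] in [r x] number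
    [d * #|A|], and each [u] of the union lies in at most [d] of them. *)
Lemma regular_perfect_matching (T U : finType) (r : T -> {set U}) (d : nat) :
    0 < d -> (forall x, #|r x| = d) ->
    (forall u, #|[set x | u \in r x]| <= d) ->
  exists2 f : T -> U, injective f & forall x, f x \in r x.
Proof.
move=> d_gt0 rd dr; apply: hall_marriage => A.
rewrite -(leq_pmul2r d_gt0) -sum_nat_const -[leqRHS]sum_nat_const.
rewrite -(eq_bigr _ (fun x _ => rd x)).
under eq_bigr do rewrite -sum1_card.
rewrite (exchange_big_dep (mem (\bigcup_(x in A) r x))) /=; last first.
  by move=> x u xA ux; apply/bigcupP; exists x.
apply: leq_sum => u _; rewrite sum1_card.
apply: leq_trans (dr u); apply/subset_leq_card/subsetP=> x.
by rewrite !inE => /andP[].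
Qed.

(** * Maximal cliques of the derangement graph *)

Lemma derangement_graphE n (s t : 'S_n) :
  derangement_graph s t = [forall x, s x != t x].
Proof.
apply: eq_forallb => x; rewrite permM; congr (~~ _).
by apply/eqP/eqP => [{2}<-|->]; rewrite ?permKV ?permK.
Qed.

Lemma clique_inj n (C : {set 'S_n}) (s t : 'S_n) (x : 'I_n) :
  clique (@derangement_graph n) C -> s \in C -> t \in C -> s x = t x -> s = t.
Proof.
move=> /'forall_in_'forall_in_implyP clC sC tC est; apply/eqP/idPn => neq_st.
have := clC s sC t tC neq_st; rewrite derangement_graphE => /forallP/(_ x).
by rewrite est eqxx.
Qed.

(** A new row is a matching of columns with values still missing there. Each column misses
    [n - #|C|] values, and each value is missing from [n - #|C|] columns. *)
Lemma clique_extend n (C : {set 'S_n}) :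
    clique (@derangement_graph n) C -> #|C| < n ->
  exists t : 'S_n, forall s, s \in C -> forall x, s x != t x.
Proof.
move=> clC ltCn.
pose r (x : 'I_n) := ~: [set (s : 'S_n) x | s in C].
have cardr x : #|r x| = n - #|C|.
  rewrite cardsCs setCK card_ord card_in_imset // => s t sC tC.
  exact: clique_inj clC sC tC.
have [|||f injf fr] := @regular_perfect_matching _ _ r (n - #|C|).
- by rewrite subn_gt0.
- exact: cardr.
- move=> u; have -> : [set x | u \in r x] = ~: [set (s^-1 : 'S_n)%g u | s in C].
    apply/setP=> x; rewrite !inE; congr (~~ _).
    apply/imsetP/imsetP => -[s sC ->]; exists s => //.
      by rewrite permK.
    by rewrite permKV.
  rewrite cardsCs setCK card_ord card_in_imset // => s t sC tC est.
  apply: (clique_inj (x := (s^-1)%g u) clC sC tC).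
  by rewrite permKV est permKV.
exists (perm injf) => s sC x; rewrite permE; apply: contraTneq (fr x) => <-.
by rewrite inE negbK; apply/imsetP; exists s.
Qed.

(** By [clique_extend], [C] has at least [n.+1] rows; their entries in column [x] are distinct,
    hence exhaust the values. *)
Lemma maximal_clique_cover n (C : {set 'S_n.+1}) (x y : 'I_n.+1) :
  maximal_clique (@derangement_graph n.+1) C -> exists2 s, s \in C & s x = y.
Proof.
move=> /maxsetP[clC maxC].
suff le_nC : n < #|C|.
  have : [set (s : 'S_n.+1) x | s in C] = setT.
    apply/eqP; rewrite eqEcard subsetT cardsT card_ord card_in_imset //.
    by move=> s t sC tC; apply: clique_inj clC sC tC.
  by move/setP/(_ y); rewrite inE => /imsetP[s sC ->]; exists s.
rewrite ltnNge; apply/negP => leCn.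
have [t tC] := clique_extend clC leCn.
have /setP/(_ t) : t |: C = C.
  apply: maxC (subsetUr _ _).
  apply/'forall_in_'forall_in_implyP => s s_in s' s'_in neq_ss'.
  rewrite derangement_graphE; apply/forallP => x'.
  case/setU1P: s_in neq_ss' => [->|sC]; case/setU1P: s'_in => [->|s'C].
  - by rewrite eqxx.
  - by move=> _; rewrite eq_sym tC.
  - by rewrite tC.
  - by apply: contra_neq; apply: clique_inj clC sC s'C.
rewrite setU11 => /esym t_in; by have := tC t t_in ord0; rewrite eqxx.
Qed.

Lemma disconnected_agree_once n (C D : {set 'S_n.+1}) (s t : 'S_n.+1) :
    maximal_clique (@derangement_graph n.+1) C ->
    maximal_clique (@derangement_graph n.+1) D ->
    disconnected (@derangement_graph n.+1) C D ->
  s \in C -> t \in D -> #|[set x | s x == t x]| = 1.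
Proof.
move=> maxC maxD disCD sC tD.
have [clD _] := maxsetP maxD.
have cardD : #|D| = n.+1.
  rewrite -(card_in_imset (f := fun t : 'S_n.+1 => t ord0)); last first.
    by move=> t1 t2 t1D t2D; apply: clique_inj clD t1D t2D.
  rewrite -[RHS]card_ord -cardsT; congr #|pred_of_set _|; apply/setP=> y.
  have [t1 t1D <-] := maximal_clique_cover ord0 y maxD.
  by rewrite inE; apply/imsetP; exists t1.
(* Each cell of [s] is met by exactly one row of [D], and [D] has as many rows as [s] has cells. The
   terms are thus 1 on average; being at least 1, they all equal 1. *)
have sum_agree : \sum_(t1 in D) #|[set x | s x == t1 x]| = \sum_(t1 in D) 1.
  rewrite sum1_card cardD; under eq_bigr do rewrite -sum1_card.
  rewrite (exchange_big_dep predT) //= -[RHS]card_ord -[RHS]sum1_card.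
  apply: eq_bigr => x _.
  have [t1 t1D t1x] := maximal_clique_cover x (s x) maxD.
  rewrite sum1_card -(card1 t1); apply: eq_card => t2; rewrite !inE.
  apply/andP/eqP => [[t2D]|->]; rewrite inE; last by rewrite t1x.
  by rewrite -t1x eq_sym => /eqP; apply: clique_inj clD t2D t1D.
have agree_ge1 t1 : t1 \in D ->
    1 <= #|[set x | s x == t1 x]| ?= iff (1 == #|[set x | s x == t1 x]|).
  move=> t1D; split => //.
  have /'forall_in_forall_inP/(_ s sC t1 t1D) := disCD.
  rewrite derangement_graphE negb_forall => /existsP[x]; rewrite negbK => stx.
  by apply/card_gt0P; exists x; rewrite inE.
have [_] := leqif_sum agree_ge1.
by rewrite sum_agree eqxx => /esym/forall_inP/(_ t tD)/eqP.
Qed.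

(** * Exhaustive search *)

Definition agreements (u v : seq nat) : nat :=
  count (fun p => p.1 == p.2) (zip u v).

(** Backtracking: one row per key, pairwise [adj]. The candidates in [others] are pruned by [meet]
    along the way, and the survivors go to the continuation [k]. *)
Fixpoint search (T : Type) (adj meet : rel T) (key : nat -> pred T)
    (ks : seq nat) (rows others : seq T) (k : seq T -> bool) : bool :=
  if ks is a :: ks' then
    has (fun u => search adj meet key ks' (filter (adj u) rows)
                    (filter (meet u) others) k)
        (filter (key a) rows)
  else k others.

(** The branch choosing [f a] at each key [a] is never pruned. Contrapositively, a search returning
    [false] rules out such [f] and [X]. *)
Lemma search_complete (T : eqType) (adj meet : rel T) (key : nat -> pred T)
    (f : nat -> T) (X : seq T) (ks : seq nat) (rows others : seq T)
    (k : seq T -> bool) :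
    uniq ks -> {in ks, forall a, f a \in rows} ->
    {in ks, forall a, key a (f a)} ->
    {in ks &, forall a b, a != b -> adj (f a) (f b)} ->
    {in ks & X, forall a v, meet (f a) v} -> {subset X <= others} ->
    (forall others', {subset X <= others'} -> k others') ->
  search adj meet key ks rows others k.
Proof.
elim: ks rows others => [|a ks IHks] rows others /=.
  by move=> _ _ _ _ _ subX; apply.
move=> /andP[a_ks uniq_ks] rowsf keyf adjf meetf subX kX.
apply/hasP; exists (f a); first by rewrite mem_filter keyf ?rowsf ?mem_head.
have ksW b : b \in ks -> b \in a :: ks by rewrite inE orbC => ->.
apply: IHks => //.
- move=> b b_ks; rewrite mem_filter rowsf ?ksW // andbT.
  by rewrite adjf ?mem_head ?ksW //; apply: contraNneq a_ks => ->.
- by move=> b /ksW; apply: keyf.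
- by move=> b c /ksW b_ks /ksW; apply: adjf.
- by move=> b v /ksW; apply: meetf.
- by move=> v vX; rewrite mem_filter subX // andbT meetf ?mem_head.
Qed.

(* The rows of the first square are looked for as [u_0 .. u_5] with [a] the
   fixed point of [u_a], and the rows of the second one other than the identity
   as [v_1 .. v_5] with [v_a] sending [0] to [a]. *)
Definition orthogonal_search : bool :=
  let disj u v := agreements u v == 0 in
  let meet1 u v := agreements u v == 1 in
  let perms := permutations (iota 0 6) in
  search disj meet1 (fun a u => nth 0 u a == a) (iota 0 6)
    (filter (meet1 (iota 0 6)) perms) (filter (disj (iota 0 6)) perms)
    (fun vs => search disj meet1 (fun a v => head 0 v == a) (iota 1 5)
                 vs [::] predT).

Lemma orthogonal_search_false : orthogonal_search = false.
Proof. by vm_compute. Qed.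

(** Plain lists of numbers let the search run by [vm_compute]. *)
Definition word n (s : 'S_n) : seq nat := [seq val (s i) | i <- enum 'I_n].

Lemma word1 n : word (1 : 'S_n)%g = iota 0 n.
Proof.
by rewrite -val_enum_ord; apply: eq_map => i; rewrite perm1.
Qed.

Lemma nth_word n (s : 'S_n) (i : 'I_n) : nth 0 (word s) i = s i.
Proof. by rewrite (nth_map i) ?nth_ord_enum // size_enum_ord. Qed.

Lemma word_in_permutations n (s : 'S_n) : word s \in permutations (iota 0 n).
Proof.
rewrite mem_permutations -val_enum_ord /word (map_comp val s).
apply: perm_map; apply: uniq_perm; rewrite ?enum_uniq //.
  by rewrite map_inj_uniq ?enum_uniq //; apply: perm_inj.
by move=> i; rewrite mem_enum -[i](permKV s) map_f // mem_enum.
Qed.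

Lemma agreements_word n (s t : 'S_n) :
  agreements (word s) (word t) = #|[set x | s x == t x]|.
Proof.
rewrite /agreements /word zip_map count_map cardE size_filter -enumT.
by apply: eq_count => x; rewrite /= inE.
Qed.

Theorem theorem4p10 :
  ~ exists C D : {set 'S_6},
      [/\ maximal_clique (@derangement_graph 6) C,
          maximal_clique (@derangement_graph 6) D
        & disconnected (@derangement_graph 6) C D].
Proof.
case=> C [D [maxC maxD disCD]].
have [[clC _] [clD _]] := (maxsetP maxC, maxsetP maxD).
have [s0 s0C _] := maximal_clique_cover ord0 ord0 maxC.
(* Right multiplication by [s0^-1] relabels the values, which preserves agreements and sends [s0] to
   the identity. *)
pose w (s : 'S_6) := word (s * s0^-1)%g.
have w_s0 : w s0 = iota 0 6 by rewrite /w mulgV word1.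
have agree_w s t : agreements (w s) (w t) = #|[set x | s x == t x]|.
  rewrite agreements_word; congr #|pred_of_set _|; apply/setP=> x.
  by rewrite !inE !permM (inj_eq perm_inj).
have agree_clique (E : {set 'S_6}) s t :
    clique (@derangement_graph 6) E -> s \in E -> t \in E -> s != t ->
    agreements (w s) (w t) == 0.
  move=> clE sE tE neq_st; rewrite agree_w cards_eq0.
  apply/set0Pn => -[x]; rewrite inE => /eqP.
  by move/(clique_inj clE sE tE)/eqP; apply/negP.
have agree_CD s t : s \in C -> t \in D -> agreements (w s) (w t) == 1.
  by move=> sC tD; rewrite agree_w (disconnected_agree_once maxC maxD).
have agree_sym s t : agreements (w s) (w t) = agreements (w t) (w s).
  by rewrite !agree_w; apply: eq_card => x; rewrite !inE eq_sym.
have cover (E : {set 'S_6}) (x y : 'I_6) :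
    maximal_clique (@derangement_graph 6) E ->
  exists s, (s \in E) && (s x == s0 y).
  move=> /(maximal_clique_cover x (s0 y))[s sE sx].
  by exists s; rewrite sE sx eqxx.
have nth_w (s : 'S_6) (x y : 'I_6) : s x = s0 y -> nth 0 (w s) x == y.
  by move=> sx; rewrite nth_word permM sx permK.
(* After relabelling, [f a] is the row of [D] fixing [a], and [g a] the row of [C] sending 0 to
   [a]. *)
pose f (a : nat) := xchoose (cover D (inord a) (inord a) maxD).
pose g (a : nat) := xchoose (cover C ord0 (inord a) maxC).
have fP a : f a \in D /\ f a (inord a) = s0 (inord a).
  by have /andP[? /eqP] := xchooseP (cover D (inord a) (inord a) maxD).
have gP a : g a \in C /\ g a ord0 = s0 (inord a).
  by have /andP[? /eqP] := xchooseP (cover C ord0 (inord a) maxC).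
(* A common row would agree with [s0] at both [a] and [b]. *)
have f_inj a b : a < 6 -> b < 6 -> f a = f b -> a = b.
  move=> lta ltb eq_f; have [fD fa] := fP a; have [_ fb] := fP b.
  have /eqP/cards1P[x /setP agr] :=
    disconnected_agree_once maxC maxD disCD s0C fD.
  have := agr (inord a); have := agr (inord b).
  rewrite !inE fa {1}eq_f fb !eqxx => /esym/eqP <- /esym/eqP/(congr1 val).
  by rewrite /= !inordK.
have g_inj a b : a < 6 -> b < 6 -> g a = g b -> a = b.
  move=> lta ltb eq_g; have [_ ga] := gP a; have [_ gb] := gP b.
  move: ga; rewrite eq_g gb => /perm_inj/(congr1 val).
  by rewrite /= !inordK.
have g_neq_s0 a : 0 < a < 6 -> s0 != g a.
  move=> /andP[a_gt0 lta]; apply: contraL a_gt0 => /eqP eq_s0.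
  have [_] := gP a; rewrite -eq_s0 => /perm_inj/(congr1 val) /=.
  by rewrite inordK // => <-.
suff: orthogonal_search by rewrite orthogonal_search_false.
have range1 a : a \in iota 1 5 -> 0 < a < 6 by rewrite mem_iota.
have range0 a : a \in iota 0 6 -> a < 6 by rewrite mem_iota.
(* [X] omits [g 0], which is [s0]: the identity row is built into the initial filters. *)
apply: (search_complete (f := fun a => w (f a))
                        (X := [seq w (g a) | a <- iota 1 5])).
- exact: iota_uniq.
- move=> a _; have [fD _] := fP a.
  by rewrite mem_filter word_in_permutations -w_s0 agree_CD.
- move=> a /range0 lta; have [_ /nth_w] := fP a.
  by rewrite inordK.
- move=> a b /range0 lta /range0 ltb; apply: contraNT => /negP agr.
  apply/eqP/f_inj => //; apply/eqP/idPn => neq_f; case: agr.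
  by apply: agree_clique clD _ _ neq_f; apply: (fP _).1.
- move=> a _ _ /mapP[b _ ->].
  by rewrite agree_sym agree_CD ?(gP b).1 ?(fP a).1.
- move=> _ /mapP[a /range1 a_in ->].
  rewrite mem_filter word_in_permutations andbT -w_s0.
  by apply: agree_clique clC s0C _ (g_neq_s0 a a_in); apply: (gP a).1.
move=> vs sub_vs.
(* The inner search picks the rows of [C] among the survivors; no third family remains, so [X] is
   empty. *)
apply: (search_complete (f := fun a => w (g a)) (X := [::])) => //.
- by move=> a a_in; apply/sub_vs/mapP; exists a.
- move=> a /range1/andP[_ lta]; have [_ /nth_w] := gP a.
  by rewrite inordK // -nth0.
- move=> a b /range1/andP[_ lta] /range1/andP[_ ltb].
  apply: contraNT => /negP agr.
  apply/eqP/g_inj => //; apply/eqP/idPn => neq_g; case: agr.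
  by apply: agree_clique clC _ _ neq_g; apply: (gP _).1.
Qed.
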